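(* Let $\mathbb{F}_q$ be a finite field of characteristic at least five, let $\tau$ be a nonzero element of $\mathbb{F}_q$, and let $n>1$ be an integer. Then \[ |\mathcal{I}(x^3-\tau x,\,1,\,n,\,q)|=\frac{1}{3n_3}\Bigl(I\bigl(n/n_3,q^{n_3}\bigr)-I\bigl(n/n_3,\varepsilon\bigr)\Bigr), \] where $\varepsilon=\left(\frac{q}{3}\right)$ is the Legendre symbol.
   Context: For coprime $g,h\in\mathbb{F}_q[x]$ and an integer $n>1$, $\mathcal{I}(g,h,n,q)$ denotes the set of monic irreducible polynomials $f\in\mathbb{F}_q[x]$ of degree $n$ such that $h(x)^n f\bigl(g(x)/h(x)\bigr)$ is irreducible in $\mathbb{F}_q[x]$. $n_3$ denotes the largest power of $3$ dividing $n$. For a positive integer $k$ and any integer $Q$ (not necessarily a prime power, possibly negative), $I(k,Q)=\frac1k\sum_{d\mid k}\mu(d)Q^{k/d}$, where $\mu$ is the Möbius function. The Legendre symbol $\varepsilon=\left(\frac{q}{3}\right)$ equals $1$ if $q\equiv 1\pmod 3$ and $-1$ if $q\equiv -1\pmod 3$. *)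

(* Defs.v *)
From HB Require Import structures.
From mathcomp Require Import all_boot all_order all_algebra.

Set Implicit Arguments.
Unset Strict Implicit.
Unset Printing Implicit Defensive.

Import Order.TTheory GRing.Theory Num.Theory.
Local Open Scope ring_scope.

(* h(x)^n f(g(x)/h(x)), with denominators cleared; see [ratsubst_fracE]. *)
Definition ratsubst (F : fieldType) (g h : {poly F}) (n : nat) (f : {poly F}) :
    {poly F} :=
  \sum_(i < n.+1) f`_i *: (g ^+ i * h ^+ (n - i)).

Lemma ratsubst_fracE (F : fieldType) (g h f : {poly F}) (n : nat) :
  h != 0 -> (size f <= n.+1)%N ->
  tofrac (ratsubst g h n f)
  = tofrac h ^+ n
    * (map_poly (fun c : F => tofrac c%:P) f).[tofrac g / tofrac h]
  :> {fraction {poly F}}.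
Proof.
move=> h0 szf.
have h0' : tofrac h != 0 :> {fraction {poly F}} by rewrite tofrac_eq0.
rewrite (@horner_coef_wide _ n.+1); last exact: leq_trans (size_poly _ _) szf.
rewrite /ratsubst rmorph_sum mulr_sumr; apply: eq_bigr => -[i /= lin] _.
rewrite coef_map_id0 ?tofrac0 // -mul_polyC !rmorphM !rmorphXn /=.
rewrite expr_div_n -[in tofrac h ^+ n](subnK (lin : (i <= n)%N)) exprD.
rewrite [RHS]mulrCA; congr (_ * _).
by rewrite [RHS]mulrCA mulfK ?expf_neq0.
Qed.

(* A polynomial of degree n has size n.+1, so all the candidates live in the
   finite type {poly_n.+1 F}. *)
Definition irr_set (F : finFieldType) (g h : {poly F}) (n : nat) :
    {set {poly_n.+1 F}} :=
  [set f : {poly_n.+1 F} |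
    [&& (f : {poly F}) \is monic, size f == n.+1, irreducibleb f
      & irreducibleb (ratsubst g h n f)]].

Lemma irr_setP (F : finFieldType) (g h p : {poly F}) (n : nat) :
  (exists2 f : {poly_n.+1 F}, f \in irr_set g h n & f = p :> {poly F}) <->
  [/\ p \is monic, size p = n.+1, irreducible_poly p
    & irreducible_poly (ratsubst g h n p)].
Proof.
split=> [[f + <-]|[pm ps /irreducibleP pi /irreducibleP pri]].
  by rewrite inE => /and4P[? /eqP ? /irreducibleP ? /irreducibleP ?].
have fE : npolyp n.+1 p = p :> {poly F} by rewrite npolypK // ps.
by exists (npolyp n.+1 p); rewrite // inE fE pm ps eqxx pi pri.
Qed.

Definition moebius (d : nat) : int :=
  if (0 < d)%N && all (fun p => logn p d == 1) (primes d)
  then (-1) ^+ size (primes d) else 0.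

Definition necklace (k : nat) (Q : int) : rat :=
  k%:R^-1 * \sum_(d <- divisors k) (moebius d * Q ^+ (k %/ d))%:~R.

(* Legendre symbol (a / p), intended for p an odd prime *)
Definition legendre (a : int) (p : nat) : int :=
  if (p %| a)%Z then 0
  else if [exists x : 'I_p, ((x%:Z ^+ 2)%R == a %[mod p])%Z] then 1
  else -1.

Lemma legendre3E (q : nat) :
  legendre q 3 = if (q %% 3 == 1)%N then 1
                 else if (q %% 3 == 2)%N then -1 else 0.
Proof.
rewrite /legendre; have -> : (3 %| q%:Z)%Z = (q %% 3 == 0)%N by [].
have qm : (q%:Z %% 3)%Z = (q %% 3)%N by rewrite modz_nat.
have : (q %% 3 < 3)%N by rewrite ltn_mod.
move: qm; case: (q %% 3)%N => [|[|[|]]] //= qm _.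
  by case: existsP => // -[]; exists (@Ordinal 3 1 isT); rewrite qm.
by case: existsP => // -[[[|[|[|]]] //= xlt]]; rewrite qm.
Qed.

(* Main.v *)
Require Import Defs.
From mathcomp Require Import all_boot all_order all_algebra all_field.
From mathcomp Require Import zify ring.
Import Order.TTheory GRing.Theory Num.Theory.
Set Implicit Arguments.
Unset Strict Implicit.
Unset Printing Implicit Defensive.
Local Open Scope ring_scope.

(** Put q = #|F|, g(x) = x^3 - tau x and eps = (q/3), and fix a finite field L
    containing F in which every polynomial needed below splits.  The degree of
    an element of L over F is the size of its orbit under the q-power
    Frobenius, and the product of the X - y over that orbit is its minimal
    polynomial ([minimal_poly]).

    If f is monic irreducible of degree n and f(g(x)) is irreducible, then the
    3n roots b of f(g(x)) have deg b = 3n and deg (g b) = n; conversely, such a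
    b determines f as the minimal polynomial of g b.  So 3n times the
    cardinal to be computed is the cardinal T(n) of [tripling n], the set of
    these b ([card_tripling]).

    Now let Q = q^m.  The b with g b in F_Q whose conjugates under the Q-power
    Frobenius Phi are the three roots of g(x) = g b are the solutions of
      b + Phi b + Phi^2 b = 0,   b^2 + b Phi b + (Phi b)^2 = tau.
    With w a primitive cube root of unity, the Lagrange resolvents
    R = b + w Phi b + w^2 Phi^2 b and R' = b + w^2 Phi b + w Phi^2 b satisfy
    R + R' = 3b and R R' = 3 tau, so b and R determine each other.  If
    Q = 1 mod 3, Phi fixes w and the condition on R is R^(Q-1) = w^2; if
    Q = 2 mod 3, Phi exchanges w and w^2 and the condition is
    R^(Q+1) = 3 tau w.  Hence there are exactly Q - (Q/3) = q^m - eps^m such b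
    ([card_three_cycles_split], [card_three_cycles_inert]).

    In terms of degrees these b are those with deg (g b) | m, deg b | 3m but
    not deg b | m.  As deg b is at most 3 deg (g b), this forces
    deg b = 3 deg (g b) with m / deg (g b) prime to 3 ([weak_tripling_degree]).
    Writing m = n_3 k with k prime to 3 gives
      q^m - eps^m = sum over j | k of T(n_3 j)
    ([card_weak_tripling_legendre], [card_weak_tripling_divisors]), and Moebius
    inversion over the divisors of n / n_3, together with eps^(n_3) = eps,
    yields the formula. *)

(** * Moebius inversion *)

Lemma moebius_prime_mul (p d : nat) :
  prime p -> (0 < d)%N -> ~~ (p %| d)%N -> moebius (p * d) = - moebius d.
Proof.
move=> pp d0 npd; have p0 := prime_gt0 pp.
have npr : p \notin primes d by rewrite mem_primes pp d0.
have pE : perm_eq (primes (p * d)) (p :: primes d).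
  apply: uniq_perm; rewrite ?primes_uniq //= ?npr ?primes_uniq // => l.
  by rewrite primesM // primes_prime // !inE.
rewrite /moebius muln_gt0 p0 d0 (perm_all _ pE) (perm_size pE) /=.
have lp : logn p (p * d) = 1%N.
  by rewrite lognM // (pfactorK 1 pp) lognE pp d0 (negPf npd).
have -> : all (fun l => logn l (p * d) == 1%N) (primes d)
        = all (fun l => logn l d == 1%N) (primes d).
  apply: eq_in_all => l lP; rewrite lognM // [X in (X + _)%N]lognE.
  have /and3P [pl _ _] : [&& prime l, (0 < d)%N & (l %| d)%N].
    by rewrite -mem_primes.
  have : ~~ (l %| p)%N.
    rewrite dvdn_prime2 //; apply: contraNneq npr => <- //.
  by move/negPf => ->; rewrite !andbF.
rewrite lp eqxx /= exprS mulN1r; case: ifP => // _; by rewrite oppr0.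
Qed.

Lemma moebius_square_dvd (p d : nat) :
  prime p -> (p ^ 2 %| d)%N -> moebius d = 0.
Proof.
move=> pp p2d; rewrite /moebius; case: ifP => // /andP [d0 /allP sqf].
have := p2d; rewrite pfactor_dvdn // => lp.
have : p \in primes d by rewrite mem_primes pp d0 (dvdn_trans _ p2d) ?dvdn_exp.
by move/sqf/eqP => E; rewrite E in lp.
Qed.

(** For p the smallest prime factor of m > 1, the divisors of m divisible by
    p^2 contribute nothing, and d -> p d pairs the divisors prime to p with the
    remaining ones, with opposite signs. *)
Lemma sum_moebius (m : nat) : (0 < m)%N ->
  \sum_(d <- divisors m) moebius d = (m == 1)%N%:R.
Proof.
rewrite leq_eqVlt => /predU1P [<-|m1].
  by rewrite big_seq1 /moebius.
have m0 := ltnW m1; rewrite gtn_eqF //.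
have pp := pdiv_prime m1; have pm := pdiv_dvd m; set p := pdiv m in pp pm.
have p0 := prime_gt0 pp.
rewrite (bigID (fun d => (p ^ 2 %| d)%N)) /= big1 ?add0r; last first.
  by move=> d; exact: moebius_square_dvd.
rewrite (bigID (fun d => (p %| d)%N)) /=.
pose s := [seq (p * d)%N | d <- divisors m & ~~ (p %| d)%N].
have sP : perm_eq [seq d <- divisors m | ~~ (p ^ 2 %| d)%N && (p %| d)%N] s.
  apply: uniq_perm; first by rewrite filter_uniq ?divisors_uniq.
    rewrite map_inj_uniq ?filter_uniq ?divisors_uniq // => x y /eqP.
    by rewrite eqn_pmul2l // => /eqP.
  move=> d; rewrite mem_filter; apply/idP/mapP.
    case/andP => /andP [np2] /dvdnP [d' dE]; rewrite dE mulnC in np2 *.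
    rewrite -dvdn_divisors // => dm; exists d' => //.
    rewrite mem_filter -dvdn_divisors // (dvdn_trans _ dm) ?dvdn_mull // andbT.
    by move: np2; rewrite expnS expn1 dvdn_pmul2l.
  case=> d'; rewrite mem_filter -dvdn_divisors // => /andP [npd' d'm] ->.
  rewrite expnS expn1 dvdn_pmul2l // npd' dvdn_mulr // -dvdn_divisors //.
  by rewrite Gauss_dvd ?pm // prime_coprime.
rewrite -big_filter (perm_big _ sP) /s big_map big_filter addrC.
rewrite (eq_bigl (fun d => ~~ (p %| d)%N)); last first.
  move=> d /=; case pd : (p %| d)%N; rewrite ?andbF // andbT.
  by apply/negP => p2d; move: pd; rewrite (dvdn_trans _ p2d) ?dvdn_exp.
rewrite -big_split /= big_seq_cond big1 // => d /andP [dm npd].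
have d0 : (0 < d)%N by apply: (dvdn_gt0 m0); rewrite dvdn_divisors.
by rewrite moebius_prime_mul // subrr.
Qed.

(** Substituting the hypothesis in the right-hand side and exchanging the sums,
    the coefficient of b i is the sum of moebius over the divisors of k / i. *)
Lemma moebius_inversion (b e : nat -> int) (k : nat) : (0 < k)%N ->
  (forall j, (j %| k)%N -> e j = \sum_(i <- divisors j) b i) ->
  b k = \sum_(d <- divisors k) moebius d * e (k %/ d)%N.
Proof.
move=> k0 eE.
(* A common index type for the divisors of all the divisors of k, so that the
   sums can be exchanged. *)
have divE (F : nat -> int) m : (m %| k)%N ->
    \sum_(d <- divisors m) F d = \sum_(d < k.+1 | (d %| m)%N) F d.
  move=> mk; have m0 := dvdn_gt0 k0 mk.
  rewrite -(big_mkord (fun d => d %| m)%N F) /index_iota subn0.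
  rewrite -[RHS]big_filter; apply: perm_big.
  apply: uniq_perm; rewrite ?divisors_uniq ?filter_uniq ?iota_uniq //.
  move=> d; rewrite mem_filter -dvdn_divisors // mem_iota /= add0n ltnS.
  case dm : (d %| m)%N => //=; apply/esym/dvdn_leq => //; exact: dvdn_trans mk.
rewrite divE //.
rewrite (eq_bigr (fun d : 'I_k.+1 =>
   \sum_(i < k.+1 | (i %| k %/ d)%N) moebius d * b i)); last first.
  move=> d dk; rewrite eE ?divE -?mulr_sumr //; exact: dvdn_div.
have dvdE i d : (d %| k -> (i %| k %/ d) = (i * d %| k))%N.
  move=> dk; rewrite -[in RHS](divnK dk) dvdn_pmul2r //; exact: dvdn_gt0 dk.
rewrite (exchange_big_dep (fun i : 'I_k.+1 => (i %| k)%N)) /=; last first.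
  by move=> d i dk; rewrite dvdE //; apply: dvdn_trans; rewrite dvdn_mulr.
rewrite (eq_bigr (fun i : 'I_k.+1 => (k %/ i == 1)%N%:R * b i)); last first.
  move=> i ik; rewrite -mulr_suml -sum_moebius; last first.
    by rewrite divn_gt0 ?(dvdn_gt0 k0 ik) // dvdn_leq.
  rewrite divE ?dvdn_div //; congr (_ * _); apply: eq_bigl => d.
  apply/andP/idP => [[dk]|dki]; first by rewrite !dvdE // mulnC.
  have dk : (d %| k)%N by apply: dvdn_trans dki (dvdn_div _).
  by rewrite dk dvdE // mulnC -dvdE.
rewrite (bigD1 (Ordinal (ltnSn k))) //= divnn k0 mul1r big1 ?addr0 // => i.
case/andP => ik nik; case: eqP => [E|]; last by rewrite mul0r.
by case/eqP: nik; apply/val_inj; rewrite /= -[RHS](divnK ik) E mul1n.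
Qed.

(** * Finite fields, Frobenius and conjugates *)

(** A finite substitute for the algebraic closure: the splitting field of the
    product of all nonzero polynomials of size at most M. *)
Lemma finite_extension_splitting (F : finFieldType) (M : nat) :
  exists (L : finFieldType) (iota : {rmorphism F -> L}),
    forall f : {poly F}, f != 0 -> (size f <= M)%N ->
    exists s : seq L, map_poly iota f %= \prod_(z <- s) ('X - z%:P).
Proof.
pose P : {poly F} := \prod_(f : {poly_M F} | f != 0 :> {poly F}) (f : {poly F}).
have P0 : P != 0 by rewrite prodf_seq_neq0; apply/allP => f _; apply/implyP.
have [L [rs rsP _]] := FinSplittingFieldFor P0.
exists (FinFieldExtType L), (in_alg L) => f f0 szf.
have : map_poly (in_alg L) f %| \prod_(z <- rs) ('X - z%:P).
  rewrite -(eqp_dvdr _ rsP) dvdp_map.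
  have fE : npolyp M f = f :> {poly F} by rewrite npolypK.
  rewrite /P (bigD1 (npolyp M f)) /=; last by rewrite fE.
  by rewrite fE dvdp_mulr.
by case/dvdp_prod_XsubC => m; exists (mask m rs).
Qed.

Lemma Frobenius_power_morphism (L : finFieldType) (p e : nat) :
  p \in [pchar L] ->
  exists phi : {rmorphism L -> L}, forall x, phi x = x ^+ (p ^ e).
Proof.
move=> pL; elim: e => [|e [phi phiE]]; first by exists idfun => x.
exists (pFrobenius_aut pL \o phi) => x /=.
by rewrite pFrobenius_autE phiE -exprM expnSr.
Qed.

Lemma iter_order_dvd (T : finType) (f : T -> T) (x : T) (m : nat) :
  injective f -> (iter m f x == x) = (fingraph.order f x %| m)%N.
Proof.
move=> injf; set d := fingraph.order f x.
have iterM k : iter (k * d) f x = x.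
  by elim: k => // k IH; rewrite mulSn iterD IH iter_order.
rewrite {1}(divn_eq m d) addnC iterD iterM /dvdn.
have ltd : (m %% d < d)%N by rewrite ltn_mod order_gt0.
apply/eqP/eqP => [E|-> //].
by rewrite -(findex_iter ltd) E findex0.
Qed.

(** In this section [deg x], the length of the Frobenius orbit of x, plays the
    role of the degree of x over F; [irreducible_root] justifies the name. *)
Section Conjugates.

Variables (F L : finFieldType) (iota : {rmorphism F -> L}).
Variable phi : {rmorphism L -> L}.
Hypothesis phiE : forall x, phi x = x ^+ #|F|.

Local Notation "f ^%L" := (map_poly iota f) (at level 2, format "f ^%L").
Local Notation deg := (fingraph.order phi).

Lemma Frobenius_iota c : phi (iota c) = iota c.
Proof. by rewrite phiE -rmorphXn expf_card. Qed.

(** X^q - X has at most q roots, and the q elements of F are among them. *)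
Lemma Frobenius_fixed y : phi y = y -> exists c, y = iota c.
Proof.
move=> phiy; suff /existsP [c /eqP] : [exists c, y == iota c] by exists c.
apply: contraT => /existsPn y_nim.
pose rs := y :: [seq iota c | c <- enum F].
have sz : size ('X^#|F| - 'X : {poly L}) = #|F|.+1.
  rewrite size_polyDl size_polyXn // size_polyN size_polyX ltnS.
  exact: finNzRing_gt1.
suff : (size rs < #|F|.+1)%N by rewrite /= size_map -cardE ltnn.
rewrite -sz; apply: max_poly_roots.
- by rewrite -size_poly_eq0 sz.
- rewrite /= rootE !hornerE -phiE phiy subrr eqxx /=.
  apply/allP => _ /mapP [c _ ->].
  by rewrite rootE !hornerE -phiE Frobenius_iota subrr.
- rewrite /= map_inj_uniq ?enum_uniq ?andbT; last exact: fmorph_inj.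
  by apply/mapP => -[c _ E]; case/eqP: (y_nim c).
Qed.

Lemma root_Frobenius (f : {poly F}) x : root f^%L x -> root f^%L (phi x).
Proof.
rewrite !rootE => /eqP fx.
have -> : f^%L = map_poly phi f^%L.
  by rewrite -map_poly_comp; apply/esym/eq_map_poly => c; exact: Frobenius_iota.
by rewrite horner_map fx rmorph0.
Qed.

Lemma map_poly_surj (P : {poly L}) : map_poly phi P = P ->
  exists f : {poly F}, P = f^%L.
Proof.
move=> PP.
have coefP i : exists c, P`_i == iota c.
  by have [|c ->] := @Frobenius_fixed P`_i; [rewrite -coef_map PP | exists c].
exists (\poly_(i < size P) xchoose (coefP i)).
apply/polyP => i; rewrite coef_map coef_poly.
case: ltnP => [_|szP]; first exact/eqP/(xchooseP (coefP i)).
by rewrite nth_default // raddf0.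
Qed.

(** The product of the X - y over the orbit of x is invariant under Frobenius,
    hence has coefficients in F.  Since the roots in L of a polynomial over F
    are stable under Frobenius, any such polynomial with one root in the orbit
    is a multiple of this product; this gives both its minimality and its
    irreducibility. *)
Lemma minimal_poly x : exists h : {poly F},
  [/\ h \is monic, size h = (deg x).+1, irreducible_poly h,
      forall f, root f^%L x = (h %| f)
    & h^%L = \prod_(y <- orbit phi x) ('X - y%:P)].
Proof.
pose P := \prod_(y <- orbit phi x) ('X - y%:P).
have injphi : injective phi by exact: fmorph_inj.
have [h Ph] : exists h, P = h^%L.
  apply: map_poly_surj; rewrite map_prod_XsubC.
  have : perm_eq (map phi (orbit phi x)) (orbit phi x).
    apply: uniq_perm; rewrite ?map_inj_uniq ?orbit_uniq // => y.
    have [y' ->] : exists y', y = phi y'.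
      by case: (injF_bij injphi) => g _ K; exists (g y).
    rewrite mem_map // -!fconnect_orbit.
    by rewrite -same_fconnect1_r.
  move=> perm; rewrite -(big_map phi predT (fun y => 'X - y%:P)).
  exact: perm_big.
have mP : P \is monic by exact: monic_prod_XsubC.
have mh : h \is monic by move: mP; rewrite Ph map_monic.
have szh : size h = (deg x).+1.
  by rewrite -(size_map_poly iota) -Ph size_prod_XsubC size_orbit.
have allroot (f : {poly F}) y : y \in orbit phi x -> root f^%L y -> h %| f.
  move=> yx fy; rewrite -(dvdp_map iota) -Ph.
  apply: uniq_roots_dvdp; last by rewrite uniq_rootsE orbit_uniq.
  apply/allP => z; rewrite -fconnect_orbit => xz.
  have xy : fconnect phi x y by rewrite fconnect_orbit.
  have : fconnect phi y z by rewrite -(same_connect (fconnect_sym injphi) xy).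
  move/iter_findex => <-.
  elim: (findex _ _ _) => //= k; exact: root_Frobenius.
exists h; split => //.
- split; first by rewrite szh ltnS order_gt0.
  move=> d szd dh; rewrite /eqp dh /=.
  have : d^%L %| P by rewrite Ph dvdp_map.
  case/dvdp_prod_XsubC => m Dm.
  have := eqp_size Dm; rewrite size_map_poly size_prod_XsubC => sz.
  case Em: (mask m (orbit phi x)) Dm => [|y r] Dm.
    by move: szd; rewrite sz Em.
  apply: (allroot d y); first by apply: (@mem_mask _ _ m); rewrite Em mem_head.
  by rewrite (eqp_root Dm) root_prod_XsubC mem_head.
- move=> f; apply/idP/idP; first by apply: allroot; rewrite -fconnect_orbit.
  rewrite -(dvdp_map iota) -Ph -dvdp_XsubCl; apply: dvdp_trans.
  by rewrite dvdp_XsubCl root_prod_XsubC -fconnect_orbit.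
Qed.

Lemma irreducible_root (f : {poly F}) x : irreducible_poly f -> root f^%L x ->
  size f = (deg x).+1 /\ #|[set y | root f^%L y]| = deg x.
Proof.
move=> irrf fx; have [h [mh szh irrh hP hE]] := minimal_poly x.
have hf : h %= f.
  by apply: irrf; [rewrite szh eqSS -lt0n order_gt0 | rewrite -hP].
split; first by rewrite -(eqp_size hf).
rewrite -size_orbit -(card_uniqP (orbit_uniq phi x)).
apply: eq_card => y; rewrite inE.
have -> : root f^%L y = root h^%L y by apply/esym/eqp_root; rewrite eqp_map.
by rewrite hE root_prod_XsubC.
Qed.

Lemma monic_irreducible_root_inj (f g : {poly F}) x :
  f \is monic -> g \is monic -> irreducible_poly f -> irreducible_poly g ->
  root f^%L x -> root g^%L x -> f = g.
Proof.
move=> mf mg irrf irrg fx gx; have [h [mh szh irrh hP hE]] := minimal_poly x.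
have sz : size h != 1 by rewrite szh eqSS -lt0n order_gt0.
apply/eqP; rewrite -eqp_monic //; apply: (@eqp_trans _ h).
  by rewrite eqp_sym; apply: irrf => //; rewrite -hP.
by apply: irrg => //; rewrite -hP.
Qed.

End Conjugates.

(** If N = m k + 1 then X^m - c divides X^(N - 1) - c^k = X^(N - 1) - 1, hence
    X^N - X; the latter is split, and separable because its derivative is -1. *)
Lemma card_power_roots (L : finFieldType) (m k : nat) (c : L) (s : seq L) :
  'X^((m * k).+1) - 'X %= \prod_(z <- s) ('X - z%:P) ->
  (m * k).+1%:R = 0 :> L -> (0 < m)%N -> c ^+ k = 1 ->
  #|[set x : L | x ^+ m == c]| = m.
Proof.
move=> Ds p0 m0 ck.
have sep : uniq s.
  rewrite -separable_prod_XsubC -(eqp_separable Ds) unlock /separable_poly.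
  rewrite derivB derivXn derivX /= -scaler_nat p0 scale0r sub0r.
  by rewrite coprimep_sym -scaleN1r coprimepZl ?oppr_eq0 ?oner_eq0 // coprime1p.
have szc : size ('X^m - c%:P) = m.+1 by rewrite size_XnsubC.
have : 'X^m - c%:P %| \prod_(z <- s) ('X - z%:P).
  rewrite -(eqp_dvdr _ Ds).
  have -> : 'X^((m * k).+1) - 'X = 'X * ('X^(m * k) - 1) :> {poly L}.
    by rewrite exprS mulrBr mulr1.
  rewrite dvdp_mull // exprM.
  have -> : 1 = (c ^+ k)%:P :> {poly L} by rewrite ck.
  rewrite rmorphXn /= subrXX dvdp_mulr //.
case/dvdp_prod_XsubC => r Dr.
have := eqp_size Dr; rewrite szc size_prod_XsubC => -[szr].
rewrite [RHS]szr -(card_uniqP (mask_uniq sep r)); apply: eq_card => x.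
by rewrite inE -root_prod_XsubC -(eqp_root Dr) rootE !hornerE subr_eq0.
Qed.

(** * Cubics whose roots are permuted cyclically *)

Lemma card_can_in (T U : finType) (A : {set T}) (B : {set U})
    (f : T -> U) (g : U -> T) :
  {in A, forall x, f x \in B} -> {in B, forall y, g y \in A} ->
  {in A, cancel f g} -> {in B, cancel g f} -> #|A| = #|B|.
Proof.
move=> fAB gBA fK gK; rewrite -(card_in_imset (can_in_inj fK)).
apply: eq_card => y; apply/imsetP/idP => [[x xA ->]|yB]; first exact: fAB.
by exists (g y); rewrite ?gBA ?gK.
Qed.

(** The form in which a relation z = 0, such as w^2 + w + 1 = 0, enters ring
    computations: k is the cofactor of z in x - y. *)
Lemma eq_linear_comb (R : nzRingType) (z k x y : R) :
  z = 0 -> x - y = z * k -> x = y.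
Proof. by move=> -> /eqP; rewrite mul0r subr_eq0 => /eqP. Qed.

Definition cubic (L : nzRingType) (t x : L) : L := x ^+ 3 - t * x.

Section ThreeCycles.

Variables (L : finFieldType) (Phi : {rmorphism L -> L}) (t w : L).
Hypotheses (t0 : t != 0) (Phi_t : Phi t = t).
Hypotheses (w3 : w ^+ 2 + w + 1 = 0) (three0 : 3%:R != 0 :> L).

(** The b such that Phi permutes the three roots of cubic t x = cubic t b
    cyclically. *)
Definition three_cycles := [set b : L |
  [&& Phi (cubic t b) == cubic t b, Phi b != b & Phi (Phi (Phi b)) == b]].

(** If x <> y have the same image under the cubic, then x^2 + x y + y^2 = t.
    Applying this to (b, Phi b) and (Phi b, Phi^2 b) and subtracting shows that
    b, Phi b, Phi^2 b add up to zero.  Conversely the two equations exclude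
    Phi b = b, which would give 3 b = 0 and then t = 0. *)
Lemma three_cyclesP b : reflect
  (b + Phi b + Phi (Phi b) = 0 /\ b ^+ 2 + b * Phi b + Phi b ^+ 2 = t)
  (b \in three_cycles).
Proof.
have Phig x : Phi (cubic t x) = cubic t (Phi x).
  by rewrite /cubic rmorphB rmorphXn rmorphM /= Phi_t.
have quad x y : cubic t x = cubic t y -> x != y -> x ^+ 2 + x * y + y ^+ 2 = t.
  rewrite -subr_eq0 => E nxy; apply: (mulfI nxy); apply/eqP; rewrite -subr_eq0.
  by rewrite -(subrr (cubic t y)) -{1}E /cubic; apply/eqP; ring.
rewrite inE Phig; apply: (iffP and3P) => [[/eqP gb nb /eqP P3b]|[e1 e2]].
  have nPb : Phi (Phi b) != Phi b by rewrite (inj_eq (fmorph_inj Phi)).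
  have nPPb : Phi (Phi b) != b.
    by apply: contra nb => /eqP E; rewrite -{2}P3b E.
  have q1 := quad _ _ gb nb.
  have q2 : Phi (Phi b) ^+ 2 + Phi (Phi b) * Phi b + Phi b ^+ 2 = t.
    by apply: quad => //; rewrite -[LHS]Phig gb Phig.
  split; last by rewrite -q1; ring.
  rewrite -subr_eq0 in nPPb; apply: (mulfI nPPb); rewrite mulr0.
  by rewrite -(subrr t) -{1}q2 -q1; ring.
have P3b : Phi (Phi (Phi b)) = b.
  have := congr1 Phi e1; rewrite !rmorphD rmorph0 -e1 /= => E.
  by apply: (addrI (Phi b + Phi (Phi b))); rewrite E; ring.
split; last exact/eqP.
  have e3 : b ^+ 2 + b * Phi b + Phi b ^+ 2 - t = 0 by rewrite e2 subrr.
  by apply/eqP/(eq_linear_comb (k := Phi b - b) e3); rewrite /cubic; ring.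
apply: contra t0 => /eqP E; move: e1 e2; rewrite !E => e1.
have -> : b = 0.
  by apply: (mulfI three0); rewrite mulr0 -[RHS]e1; ring.
by move=> <-; rewrite expr0n mulr0 !addr0.
Qed.

(* The Lagrange resolvent R of b, and its inverse: the conjugate resolvent is
   3 t / R, and the two resolvents add up to 3 b. *)
Let res b := b + w * Phi b + w ^+ 2 * Phi (Phi b).
Let unres (R : L) := (R + 3%:R * t / R) / 3%:R.

(** Reduces the count to that of the resolvents R in a set S.  The two
    hypotheses on S are what differs between Q = 1 and Q = 2 mod 3: Phi must
    act on R and R' = 3 t / R so that (R + R') / 3 has the conjugates
    (w^2 R + w R') / 3 and (w R + w^2 R') / 3, and every resolvent must lie
    in S. *)
Lemma card_resolvents (S : {set L}) :
  {in S, forall R, let R' := 3%:R * t / R in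
    [/\ R != 0, Phi (R + R') = w ^+ 2 * R + w * R'
      & Phi (w ^+ 2 * R + w * R') = w * R + w ^+ 2 * R']} ->
  (forall b R R', R * R' = 3%:R * t ->
     R = b + w * Phi b + w ^+ 2 * Phi (Phi b) ->
     R' = b + w ^+ 2 * Phi b + w * Phi (Phi b) ->
     Phi (Phi (Phi b)) = b -> R \in S) ->
  #|three_cycles| = #|S|.
Proof.
move=> SP inS.
have Phi3 : Phi 3%:R = 3%:R by rewrite rmorph_nat.
have unresE R : R \in S ->
    [/\ Phi (unres R) = (w ^+ 2 * R + w * (3%:R * t / R)) / 3%:R
      & Phi (Phi (unres R)) = (w * R + w ^+ 2 * (3%:R * t / R)) / 3%:R].
  move=> /SP [_ E1 E2]; rewrite /unres !(rmorphM Phi, fmorphV) Phi3 E1.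
  by rewrite E2 Phi3.
have resM b : b \in three_cycles ->
    res b * (b + w ^+ 2 * Phi b + w * Phi (Phi b)) = 3%:R * t.
  case/three_cyclesP => e1 <-; rewrite /res.
  have -> : Phi (Phi b) = - b - Phi b.
    by apply: (addrI (b + Phi b)); rewrite e1; ring.
  apply: (eq_linear_comb w3 (k := b ^+ 2 * (w - 2%:R)
    + (b * Phi b + Phi b ^+ 2) * (- w ^+ 2 + 3%:R * w - 3%:R))).
  by ring.
apply: (card_can_in (f := res) (g := unres)).
- move=> b bE; apply: (inS b _ _ (resM b bE)) => //.
  by move: bE; rewrite inE => /and3P [_ _ /eqP].
- move=> R RS; have [E1 E2] := unresE R RS; have [R0 _ _] := SP R RS.
  apply/three_cyclesP; rewrite E2 E1 /unres; split.
    apply: (eq_linear_comb w3 (k := (R + 3%:R * t / R) / 3%:R)).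
    by field; rewrite three0 R0.
  apply: (eq_linear_comb w3 (k := (R ^+ 2 * (1 - w + w ^+ 2)
    + (3%:R * t / R) ^+ 2 + 3%:R * t * (2%:R * w - 1)) / 9%:R)).
  have nine0 : 9%:R != 0 :> L by rewrite (natrM _ 3 3) mulf_neq0.
  by field; rewrite three0 nine0 R0.
- move=> b bE; have rM := resM b bE.
  have R0 : res b != 0.
    have : 3%:R * t != 0 by rewrite mulf_neq0.
    by rewrite -rM mulf_eq0 negb_or => /andP [].
  have -> : unres (res b)
      = (res b + (b + w ^+ 2 * Phi b + w * Phi (Phi b))) / 3%:R.
    by rewrite /unres -rM mulrAC mulfV // mul1r.
  case/three_cyclesP: bE => e1 _.
  apply: (mulfI three0); rewrite mulrC mulfVK //.
  apply: (eq_linear_comb w3 (k := - b)); rewrite /res.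
  have -> : Phi (Phi b) = - b - Phi b.
    by apply: (addrI (b + Phi b)); rewrite e1; ring.
  ring.
- move=> R RS; have [E1 E2] := unresE R RS; have [R0 _ _] := SP R RS.
  rewrite /res E2 E1 /unres.
  apply: (eq_linear_comb w3 (k := (2%:R * R * (w - 1)
     + (3%:R * t / R) * (1 - w + w ^+ 2)) / 3%:R)).
  by field; rewrite three0 R0.
Qed.

Variable Q : nat.
Hypotheses (PhiE : forall x, Phi x = x ^+ Q).
Variable s : seq L.
Hypotheses (Q0 : Q%:R = 0 :> L) (Qgt1 : (1 < Q)%N).
(* Both kinds of resolvents have degree dividing 6 over the fixed field of Phi:
   their exponents Q - 1 and Q + 1 divide Q^6 - 1. *)
Hypothesis sP : 'X^(Q ^ 6) - 'X %= \prod_(z <- s) ('X - z%:P).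

Lemma w_cube : w ^+ 3 = 1.
Proof. by apply: (eq_linear_comb w3 (k := w - 1)); ring. Qed.

Lemma w_neq0 : w != 0.
Proof.
by have := oner_neq0 L; rewrite -w_cube expf_eq0.
Qed.

Lemma card_power_roots_Q6 (m k : nat) (c : L) : (m * k).+1 = (Q ^ 6)%N ->
  (0 < m)%N -> c ^+ k = 1 -> #|[set x : L | x ^+ m == c]| = m.
Proof.
move=> mk m0 ck; apply: (card_power_roots (s := s) _ _ m0 ck); rewrite mk //.
by rewrite natrX Q0 expr0n.
Qed.

(** Here Phi fixes w, so R is a resolvent when Phi R = w^2 R, that is when
    R^(Q-1) = w^2. *)
Lemma card_three_cycles_split : (Q %% 3 = 1)%N -> #|three_cycles| = Q.-1.
Proof.
move=> Q1; have [r rE] : exists r, Q = (r * 3).+1.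
  by exists (Q %/ 3)%N; rewrite {1}(divn_eq Q 3) Q1 addn1.
have Phi_w : Phi w = w by rewrite PhiE rE exprS mulnC exprM w_cube expr1n mulr1.
have Phi3 : Phi (3%:R * t) = 3%:R * t by rewrite rmorphM rmorph_nat /= Phi_t.
pose S := [set R : L | R ^+ Q.-1 == w ^+ 2].
have SE R : R != 0 -> (R \in S) = (Phi R == w ^+ 2 * R).
  move=> R0; rewrite inE PhiE rE /= (exprSr R); apply/eqP/eqP => [->//|].
  exact: mulIf.
rewrite (@card_resolvents S); last 2 first.
- move=> R RS /=; set R' := 3%:R * t / R.
  have R0 : R != 0.
    apply: contraTneq RS => ->; rewrite inE expr0n.
    by rewrite gtn_eqF ?ltn_predRL // eq_sym expf_eq0 /= w_neq0.
  move: RS; rewrite SE // => /eqP PR.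
  have PR' : Phi R' = w * R'.
    rewrite /R' rmorphM fmorphV Phi3 PR.
    apply/esym.
    apply: (eq_linear_comb w3 (k := (w - 1) * w ^- 2 * (3%:R * t / R))).
    by field; rewrite R0 w_neq0.
  move: R' PR' => R' PR'; split=> //; first by rewrite rmorphD PR PR'.
  rewrite rmorphD !rmorphM /= Phi_w PR PR'.
  apply: (eq_linear_comb w3 (k := w * (w - 1) * R)); ring.
- move=> b R R' RR' RE R'E P3b; rewrite SE.
    rewrite RE !rmorphD !rmorphM /= Phi_w P3b; apply/eqP.
    apply: (eq_linear_comb w3 (k := (1 - w) * (Phi b + w * Phi (Phi b)))); ring.
  have : 3%:R * t != 0 by rewrite mulf_neq0.
  by rewrite -RR' mulf_eq0 negb_or => /andP [].
(* Q^6 - 1 = (Q - 1)(1 + Q + Q^2)(1 + Q^3), and 3 divides 1 + Q + Q^2. *)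
apply: (@card_power_roots_Q6 _ ((1 + Q + Q ^ 2) * (1 + Q ^ 3)));
  rewrite ?ltn_predRL //.
  by rewrite rE; nia.
have -> : (1 + Q + Q ^ 2 = 3 * (1 + 3 * r + 3 * r ^ 2))%N by rewrite rE; nia.
by rewrite -exprM -mulnA mulnCA exprM w_cube expr1n.
Qed.

(** Here Phi exchanges w and w^2, so R is a resolvent when Phi R = w R' with
    R' = 3 t / R, that is when R^(Q+1) = 3 t w. *)
Lemma card_three_cycles_inert : (Q %% 3 = 2)%N -> #|three_cycles| = Q.+1.
Proof.
move=> Q2; have [r rE] : exists r, Q = (r * 3).+2.
  by exists (Q %/ 3)%N; rewrite {1}(divn_eq Q 3) Q2 addn2.
have Phi_w : Phi w = w ^+ 2.
  by rewrite PhiE rE 2!exprS mulnC exprM w_cube expr1n mulr1.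
have Phi3 : Phi (3%:R * t) = 3%:R * t by rewrite rmorphM rmorph_nat /= Phi_t.
have t30 : 3%:R * t != 0 by rewrite mulf_neq0.
pose S := [set R : L | R ^+ Q.+1 == 3%:R * t * w].
have SE R : R != 0 -> (R \in S) = (Phi R == w * (3%:R * t / R)).
  move=> R0; rewrite inE PhiE exprSr mulrA (mulrC w); apply/eqP/eqP.
    by move=> <-; rewrite mulfK.
  by move=> ->; rewrite mulfVK.
rewrite (@card_resolvents S); last 2 first.
- move=> R RS /=; set R' := 3%:R * t / R.
  have R0 : R != 0.
    apply: contraTneq RS => ->; rewrite inE expr0n eq_sym.
    by rewrite mulf_neq0 ?w_neq0.
  move: RS; rewrite SE // => /eqP PR.
  have PR' : Phi R' = w ^+ 2 * R.
    rewrite /R' rmorphM fmorphV Phi3 PR.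
    apply/esym; apply: (eq_linear_comb w3 (k := (w - 1) / w * R)).
    by field; rewrite R0 w_neq0 t0 three0.
  rewrite -/R' in PR; move: R' PR PR' => R' PR PR'.
  split=> //; first by rewrite rmorphD PR PR' addrC.
  rewrite rmorphD !rmorphM /= Phi_w PR PR'.
  apply: (eq_linear_comb w3 (k := (w - 1) * (w * R + w ^+ 2 * R'))); ring.
- move=> b R R' RR' RE R'E P3b.
  have R0 : R != 0.
    by move: t30; rewrite -RR' mulf_eq0 negb_or => /andP [].
  rewrite SE // -RR' (mulrAC R) mulfV // mul1r.
  rewrite RE R'E !rmorphD !rmorphM /= Phi_w P3b; apply/eqP.
  apply: (eq_linear_comb w3 (k := (1 - w) * (Phi b - w * b))); ring.
(* Q^6 - 1 = (Q + 1)(Q - 1)(Q^4 + Q^2 + 1), and 3 divides Q^4 + Q^2 + 1. *)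
apply: (@card_power_roots_Q6 _ (Q.-1 * (Q ^ 4 + Q ^ 2 + 1))) => //.
  by rewrite rE; nia.
rewrite exprM exprMn.
have -> : (3%:R * t) ^+ Q.-1 = 1.
  apply: (mulIf t30); rewrite -exprSr mul1r prednK -?PhiE //.
  exact: ltnW.
have -> : (Q ^ 4 + Q ^ 2 + 1
    = 3 * (27 * r ^ 4 + 72 * r ^ 3 + 75 * r ^ 2 + 36 * r + 7))%N.
  by rewrite rE; nia.
by rewrite mul1r exprAC exprM w_cube !expr1n.
Qed.

End ThreeCycles.

(** * Degrees of an element and of its image under the cubic *)

Lemma ratsubst_comp (F : fieldType) (g f : {poly F}) (n : nat) :
  (size f <= n.+1)%N -> ratsubst g 1 n f = f \Po g.
Proof.
move=> szf; rewrite /ratsubst /comp_poly (@horner_coef_wide _ n.+1).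
  by apply: eq_bigr => i _; rewrite expr1n mulr1 coef_map mul_polyC.
exact: leq_trans (size_poly _ _) szf.
Qed.

Section Degrees.

Variables (F L : finFieldType) (iota : {rmorphism F -> L}).
Variable phi : {rmorphism L -> L}.
Hypothesis phiE : forall x, phi x = x ^+ #|F|.
Variable tau : F.

Local Notation deg := (fingraph.order phi).
Local Notation t := (iota tau).
Local Notation g := (cubic t).

(** By [card_tripling], the roots of the irreducible composites of polynomials
    of degree m with the cubic. *)
Definition tripling (m : nat) : {set L} :=
  [set b | (deg (g b) == m) && (deg b == 3 * m)%N].

(** By [weak_tripling_three_cycles], the degree form of [three_cycles] for the
    m-th power of Frobenius. *)
Definition weak_tripling (m : nat) : {set L} :=
  [set b | [&& deg (g b) %| m, deg b %| 3 * m & ~~ (deg b %| m)]%N].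

Let phi_inj : injective phi. Proof. exact: fmorph_inj. Qed.

Lemma iter_Frobenius_cubic k b : iter k phi (g b) = g (iter k phi b).
Proof.
elim: k => //= k ->; rewrite /cubic rmorphB rmorphXn rmorphM /=.
by rewrite (Frobenius_iota iota phiE).
Qed.

Lemma iter_Frobenius k : exists Phi : {rmorphism L -> L},
  (forall x, Phi x = iter k phi x) /\ (forall x, Phi x = x ^+ (#|F| ^ k)).
Proof.
elim: k => [|k [Phi [E1 E2]]]; first by exists idfun; split.
exists (phi \o Phi); split=> x /=; first by rewrite E1.
by rewrite E2 phiE -exprM expnSr.
Qed.

Lemma weak_tripling_three_cycles m (Phi : {rmorphism L -> L}) :
  (forall x, Phi x = iter m phi x) -> weak_tripling m = three_cycles Phi t.
Proof.
move=> PhiE; apply/setP => b; rewrite !inE !PhiE -!iterD !iter_order_dvd //.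
have -> : (3 * m = m + m + m)%N by lia.
by rewrite ?addnA [X in _ && X]andbC.
Qed.

Lemma degree_cubic_dvd b : (deg (g b) %| deg b)%N.
Proof. by rewrite -iter_order_dvd // iter_Frobenius_cubic iter_order. Qed.

(** With a = deg (g b), the elements b, Phi b, Phi^2 b, Phi^3 b for Phi the a-th
    power of Frobenius are roots of the same cubic, so two of them coincide. *)
Lemma degree_cubic_ratio b :
  exists k, [/\ (0 < k)%N, (k <= 3)%N & (deg b %| k * deg (g b))%N].
Proof.
set a := deg (g b).
pose r := [seq iter (i * a) phi b | i <- seq.iota 0 4].
pose P : {poly L} := 'X^3 - (t *: 'X + (g b)%:P).
have szP : size P = 4%N.
  rewrite size_polyDl ?size_polyXn // size_polyN.
  apply: leq_ltn_trans (size_polyD _ _) _; rewrite gtn_max.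
  rewrite (leq_ltn_trans (size_scale_leq _ _)) ?size_polyX //.
  by rewrite (leq_ltn_trans (size_polyC_leq1 _)).
have rP : all (root P) r.
  apply/allP => _ /mapP [i _ ->].
  rewrite rootE !(hornerD, hornerN, hornerXn, hornerZ, hornerX, hornerC).
  rewrite opprD addrA -/(g (iter (i * a) phi b)) -iter_Frobenius_cubic.
  suff /eqP -> : iter (i * a) phi (g b) == g b by rewrite subrr.
  by rewrite iter_order_dvd // dvdn_mull.
have /(uniqPn b) [i [j [ltij ltj E]]] : ~~ uniq r.
  apply/negP => /(max_poly_roots _ rP).
  by rewrite szP -size_poly_eq0 szP /= => /(_ isT).
have {}ltj : (j < 4)%N by [].
have lti : (i < 4)%N := ltn_trans ltij ltj.
exists (j - i)%N; split; first by rewrite subn_gt0.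
  by rewrite leq_subLR; apply: leq_trans (leq_addl _ _).
rewrite -iter_order_dvd //; apply/eqP.
have inj : injective (iter (i * a) phi).
  by elim: (i * a)%N => //= k IH x y /phi_inj /IH.
apply: inj; rewrite -iterD -mulnDl subnKC ?(ltnW ltij) //.
by move: E; rewrite !(nth_map 0%N) ?size_iota // !nth_iota // !add0n.
Qed.

(** The ratio of deg b to deg (g b) is at most 3.  It is neither 1 nor 2: in
    both cases deg b, dividing m or else 2 m and 3 m, would divide m. *)
Lemma weak_tripling_degree m b :
  b \in weak_tripling m -> deg b = (3 * deg (g b))%N.
Proof.
rewrite inE => /and3P [am d3m ndm].
have [k [k0 k3 dka]] := degree_cubic_ratio b.
have := degree_cubic_dvd b; have a0 := order_gt0 phi (g b).
move: am d3m ndm dka a0; move: (deg (g b)) (deg b) => a d am d3m ndm dka a0.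
case/dvdnP => x dE.
move: d3m ndm dka; rewrite {}dE dvdn_pmul2r // => d3m ndm xk.
have x0 : (0 < x)%N by rewrite (dvdn_gt0 k0 xk).
have xle : (x <= 3)%N := leq_trans (dvdn_leq k0 xk) k3.
case: x {xk} xle x0 d3m ndm => [|[|[|[|]]]] // _ _ d3m.
  by rewrite mul1n am.
case/negP; rewrite -(dvdn_addr _ (dvdn_mul (dvdnn 2) am)).
by rewrite addnC -mulSn.
Qed.

(** Put a = deg (g b), so that deg b = 3 a.  That 3 a does not divide c k means
    that c k / a is prime to 3, so a contains the whole 3-part c. *)
Lemma weak_tripling_decomp (c k : nat) (b : L) :
  3%N.-nat c -> (0 < k)%N -> ~~ (3 %| k)%N ->
  b \in weak_tripling (c * k) <->
  exists2 j, (j %| k)%N & b \in tripling (c * j).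
Proof.
move=> c3 k0 nk3; have c0 : (0 < c)%N by case/andP: c3.
split=> [bW|[j jk]]; last first.
  rewrite !inE => /andP [/eqP -> /eqP ->].
  rewrite dvdn_pmul2l // jk dvdn_mul ?dvdn_pmul2l //=.
  rewrite mulnCA dvdn_pmul2l //; apply: contra nk3; exact/dvdn_trans/dvdn_mulr.
have dE := weak_tripling_degree bW.
move: bW; rewrite inE dE => /and3P [am _ n3a].
have [x mE] := dvdnP am.
have cx : coprime c x.
  apply: (pnat_coprime c3); rewrite p'natE //; apply: contra n3a.
  by rewrite mE => /dvdn_mul -> //.
have : (c %| deg (g b))%N.
  by rewrite -(Gauss_dvdr _ cx) -mE dvdn_mulr.
case/dvdnP => j aE; exists j; last by rewrite inE dE aE mulnC !eqxx.
by move: am; rewrite aE mulnC dvdn_pmul2l.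
Qed.

Lemma card_weak_tripling_divisors (c k : nat) :
  3%N.-nat c -> (0 < k)%N -> ~~ (3 %| k)%N ->
  #|weak_tripling (c * k)| = (\sum_(j <- divisors k) #|tripling (c * j)|)%N.
Proof.
move=> c3 k0 nk3; have c0 : (0 < c)%N by case/andP: c3.
under eq_bigr do rewrite -sum1_card big_mkcond.
rewrite exchange_big -sum1_card big_mkcond; apply: eq_bigr => b _ /=.
have WP := weak_tripling_decomp b c3 k0 nk3.
have [bW|nbW] := boolP (b \in weak_tripling _).
  have [j jk bj] := WP.1 bW.
  rewrite (bigD1_seq j) ?divisors_uniq -?dvdn_divisors //= bj big1 ?addn0 //.
  move=> i nij; case: ifP => //; move: bj; rewrite !inE => /andP [/eqP -> _].
  by rewrite eqn_pmul2l // eq_sym (negPf nij).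
rewrite big_seq big1 // => j; rewrite -dvdn_divisors // => jk.
by case: ifP => // bj; case/negP: nbW; apply/WP; exists j.
Qed.

Variable n : nat.
Hypothesis n_gt0 : (0 < n)%N.
Hypothesis splitF : forall f : {poly F}, f != 0 -> (size f <= (3 * n).+1)%N ->
  exists s : seq L, map_poly iota f %= \prod_(z <- s) ('X - z%:P).

(** Double counting of the pairs (f, b) with f in [irr_set] and f (g b) = 0.
    Each f has 3 n such b, all in [tripling n], as f and f o g are irreducible.
    For b in [tripling n], the minimal polynomial h of g b is the only possible
    f, and it qualifies: h o g has the degree 3 n of b and vanishes at b, so it
    is associate to the minimal polynomial of b. *)
Lemma card_tripling :
  #|tripling n| = (3 * n * #|irr_set ('X^3 - tau *: 'X) 1 n|)%N.
Proof.
set G : {poly F} := 'X^3 - tau *: 'X; set I := irr_set _ _ _.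
have szG : size G = 4%N.
  rewrite size_polyDl ?size_polyXn // size_polyN.
  by rewrite (leq_ltn_trans (size_scale_leq _ _)) ?size_polyX.
have G_t b : (map_poly iota G).[b] = g b.
  by rewrite rmorphB /= map_polyXn map_polyZ map_polyX !hornerE.
have root_comp (f : {poly F}) b :
    root (map_poly iota (f \Po G)) b = root (map_poly iota f) (g b).
  by rewrite !rootE map_comp_poly horner_comp G_t.
have size_comp (f : {poly F}) : size f = n.+1 -> size (f \Po G) = (3 * n).+1.
  move=> szf; have := size_comp_poly f G; rewrite szf szG /= => E.
  have sz0 : (0 < size (f \Po G))%N.
    rewrite lt0n; apply: contraTneq n_gt0 => z.
    by move: E; rewrite z; case: (n).
  by rewrite -(prednK sz0) E mulnC.
have IP (f : {poly_n.+1 F}) : f \in I ->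
    [/\ (f : {poly F}) \is monic, size f = n.+1, irreducible_poly f
      & irreducible_poly (f \Po G)].
  rewrite inE => /and4P [mf /eqP szf /irreducibleP irrf].
  by rewrite ratsubst_comp ?szf // => /irreducibleP.
have in_tripling (f : {poly_n.+1 F}) b : f \in I ->
    root (map_poly iota f) (g b) -> b \in tripling n.
  move=> /IP [mf szf irrf irrfG] fb; rewrite inE.
  have [/eqP + _] := irreducible_root phiE irrf fb.
  rewrite szf eqSS eq_sym => ->.
  rewrite -root_comp in fb; have [/eqP + _] := irreducible_root phiE irrfG fb.
  by rewrite (size_comp _ szf) eqSS eq_sym => ->.
have ex_f b : b \in tripling n ->
    exists2 f : {poly_n.+1 F}, f \in I & root (map_poly iota f) (g b).
  rewrite inE => /andP [/eqP dg /eqP db].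
  have [h [mh szh irrh hP _]] := minimal_poly iota phiE (g b).
  have [h' [mh' szh' irrh' hP' _]] := minimal_poly iota phiE b.
  rewrite dg in szh; rewrite db in szh'.
  have hE : npolyp n.+1 h = h :> {poly F} by rewrite npolypK // szh.
  exists (npolyp n.+1 h); last by rewrite hE hP.
  rewrite inE hE mh szh eqxx ratsubst_comp ?szh //.
  have -> /= : irreducibleb h by apply/irreducibleP.
  apply/irreducibleP.
  have : h' %| h \Po G by rewrite -hP' root_comp hP.
  move/dvdp_size_eqp; rewrite szh' (size_comp _ szh) eqxx => /esym hh'.
  split=> [|d szd]; first by rewrite -(eqp_size hh') irrh'.
  rewrite -(eqp_dvdr _ hh') => /(irrh' _ szd) /eqp_trans; exact.
have card_roots (f : {poly_n.+1 F}) : f \in I ->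
    #|[set b | root (map_poly iota f) (g b)]| = (3 * n)%N.
  move=> fI; have [mf szf irrf irrfG] := IP f fI.
  have szfG := size_comp _ szf.
  have [] := splitF (irredp_neq0 irrfG); first by rewrite szfG.
  move=> [|b s] sP; have := eqp_size sP.
    rewrite size_map_poly szfG size_prod_XsubC /=.
    by move/succn_inj/eqP; rewrite muln_eq0 /= -leqn0 leqNgt n_gt0.
  rewrite size_map_poly szfG size_prod_XsubC => _.
  have fb : root (map_poly iota (f \Po G)) b.
    by rewrite (eqp_root sP) root_prod_XsubC mem_head.
  have [+ card_fG] := irreducible_root phiE irrfG fb; rewrite szfG => -[->].
  by rewrite -card_fG; apply: eq_card => x; rewrite !inE root_comp.
rewrite -sum1_card mulnC -sum_nat_const.
rewrite (eq_bigr (fun b =>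
  \sum_(f in I) (root (map_poly iota f) (g b) : nat))%N).
  rewrite exchange_big; apply: eq_bigr => f fI /=.
  rewrite -(card_roots f fI) -sum1_card [RHS]big_mkcond [LHS]big_mkcond /=.
  apply: eq_bigr => b _; rewrite [in RHS]inE.
  case fb: (root _ _); first by rewrite (in_tripling f b fI fb).
  by case: ifP.
move=> b /ex_f [f fI fb].
rewrite (bigD1 f) //= fb big1 // => f' /andP [f'I nff'].
case f'b: (root _ _) => //; case/eqP: nff'; apply/val_inj => /=.
have [mf _ irrf _] := IP f fI; have [mf' _ irrf' _] := IP f' f'I.
exact: (monic_irreducible_root_inj phiE mf' mf irrf' irrf f'b fb).
Qed.

End Degrees.

(** * The count *)

Lemma legendre3_cases (q m : nat) : ~~ (3 %| q)%N ->
  (q ^ m %% 3 = 1)%N /\ legendre q 3 ^+ m = 1 \/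
  (q ^ m %% 3 = 2)%N /\ legendre q 3 ^+ m = -1.
Proof.
move=> nq3; have qr : (q %% 3 = 1)%N /\ legendre q 3 = 1 \/
    (q %% 3 = 2)%N /\ legendre q 3 = -1.
  move: nq3; rewrite legendre3E /dvdn; have := ltn_pmod q (isT : 0 < 3)%N.
  by case: (q %% 3)%N => [|[|[|]]] //; [left | right].
elim: m => [|m IH]; first by left.
rewrite expnS exprS -modnMm.
by case: qr => -[q3 e3]; case: IH => -[-> ->];
  rewrite q3 e3 ?mul1r ?mulN1r ?opprK;
  [left | right | right | left].
Qed.

Section Count.

Variables (F L : finFieldType) (iota : {rmorphism F -> L}).
Variable phi : {rmorphism L -> L}.
Hypothesis phiE : forall x, phi x = x ^+ #|F|.
Variable tau : F.
Hypotheses (tau_neq0 : tau != 0) (three0 : 3%:R != 0 :> F).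
Variable n : nat.
Hypothesis n_gt0 : (0 < n)%N.
Hypothesis splitF : forall f : {poly F}, f != 0 ->
  (size f <= (#|F| ^ (6 * n)).+1)%N ->
  exists s : seq L, map_poly iota f %= \prod_(z <- s) ('X - z%:P).

Let q_gt1 : (1 < #|F|)%N. Proof. exact: finNzRing_gt1. Qed.

Lemma exists_cube_root1 : exists w : L, w ^+ 2 + w + 1 = 0.
Proof.
have sz3 : size ('X^2 + ('X + 1) : {poly F}) = 3%N.
  by rewrite size_polyDl size_polyXn // size_XaddC.
have [||] := splitF (f := 'X^2 + ('X + 1)).
- by rewrite -size_poly_eq0 sz3.
- rewrite sz3 ltnS (leq_trans (_ : 2 <= 2 ^ (6 * n))%N) ?leq_exp2r ?muln_gt0 //.
  by rewrite (leq_pexp2l _ (_ : 1 <= 6 * n)%N) ?muln_gt0.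
move=> [|w s] sP; have := eqp_size sP;
  rewrite size_map_poly sz3 size_prod_XsubC // => _; exists w.
apply/eqP; rewrite -addrA.
have : root (map_poly iota ('X^2 + ('X + 1))) w.
  by rewrite (eqp_root sP) root_prod_XsubC mem_head.
by rewrite !rmorphD /= map_polyXn map_polyX rmorph1 rootE
  !(hornerD, hornerXn, hornerX, hornerC).
Qed.

(** [card_three_cycles_split] and [card_three_cycles_inert] for Q = q^m, whose
    residue mod 3 is read off from (q/3)^m. *)
Lemma card_weak_tripling_legendre m :
  (0 < m)%N -> (m <= n)%N -> ~~ (3 %| #|F|)%N ->
  #|F|%:R = 0 :> L ->
  #|weak_tripling iota phi tau m|%:Z = #|F|%:Z ^+ m - legendre #|F| 3 ^+ m.
Proof.
move=> m0 mn nq3 q0.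
have [w w3] := exists_cube_root1.
have [Phi [PhiI PhiE]] := iter_Frobenius phiE m.
have three0L : 3%:R != 0 :> L.
  by rewrite -(rmorph_nat iota) fmorph_eq0.
have t0 : iota tau != 0 by rewrite fmorph_eq0.
have Phi_t : Phi (iota tau) = iota tau.
  rewrite PhiI; elim: (m) => //= k ->; exact: Frobenius_iota.
rewrite (weak_tripling_three_cycles iota tau PhiI).
set Q := (#|F| ^ m)%N.
have Q1 : (1 < Q)%N by rewrite -[X in (X < _)%N](exp1n m) ltn_exp2r.
have Q0 : Q%:R = 0 :> L by rewrite natrX q0 expr0n gtn_eqF.
have [s sP] : exists s : seq L, 'X^(Q ^ 6) - 'X %= \prod_(z <- s) ('X - z%:P).
  have sz : size ('X^(Q ^ 6) - 'X : {poly F}) = (Q ^ 6).+1.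
    rewrite size_polyDl size_polyXn // size_polyN size_polyX ltnS.
    by rewrite -[X in (X < _)%N](exp1n 6) ltn_exp2r.
  have [||] := splitF (f := 'X^(Q ^ 6) - 'X).
  - by rewrite -size_poly_eq0 sz.
  - rewrite sz ltnS -expnM leq_exp2l // mulnC leq_mul2l //.
  by move=> s; rewrite rmorphB /= map_polyXn map_polyX; exists s.
have qQ : #|F|%:Z ^+ m = Q%:Z by rewrite -!natz natrX.
have [[Qm ->]|[Qm ->]] := legendre3_cases m nq3.
  rewrite (card_three_cycles_split t0 Phi_t w3 three0L PhiE Q0 Q1 sP Qm) qQ.
  by rewrite -[in RHS](prednK (ltnW Q1)) -addn1 PoszD addrK.
rewrite (card_three_cycles_inert t0 Phi_t w3 three0L PhiE Q0 Q1 sP Qm) qQ.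
by rewrite opprK -addn1 PoszD.
Qed.

End Count.

Theorem theorem13 (F : finFieldType) (p : nat) (charFp : p \in [pchar F])
    (p_ge5 : (5 <= p)%N) (tau : F) (tau_neq0 : tau != 0)
    (n : nat) (n_gt1 : (1 < n)%N) :
  let q := #|F| in
  let n3 := (n`_3)%N in
  let eps := legendre q%:Z 3 in
  (#|irr_set ('X^3 - tau *: 'X) 1 n|)%:R =
    (3 * n3)%:R^-1
    * (necklace (n %/ n3) (q%:Z ^+ n3) - necklace (n %/ n3) eps) :> rat.
Proof.
move=> q n3 eps.
have n0 : (0 < n)%N := ltnW n_gt1.
have pp : prime p := pcharf_prime charFp.
have qE : q = (p ^ logn p q)%N := card_pprimeChar charFp.
have q1 : (1 < q)%N := finNzRing_gt1 F.
have e0 : (0 < logn p q)%N.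
  by rewrite lt0n; apply: contraTneq q1 => E; rewrite qE E.
have np3 : ~~ (p %| 3)%N by rewrite gtnNdvd // (leq_trans _ p_ge5).
have nq3 : ~~ (3 %| q)%N.
  rewrite qE Euclid_dvdX // e0 andbT dvdn_prime2 // neq_ltn.
  by rewrite (leq_trans _ p_ge5).
have three0 : 3%:R != 0 :> F by rewrite -(dvdn_pcharf charFp).
(* The bound covers X^(q^(6 m)) - X for m <= n, on which the resolvents live,
   and the composites with the cubic, of degree 3 n <= q^(6 n). *)
have [L [iota splitF]] := finite_extension_splitting F (q ^ (6 * n)).+1.
have charLp : p \in [pchar L] by rewrite (fmorph_pchar iota).
have [phi phiE] := Frobenius_power_morphism (logn p q) charLp.
rewrite -qE in phiE.
have q0 : q%:R = 0 :> L by rewrite qE natrX (pcharf0 charLp) expr0n gtn_eqF.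
set k := (n %/ n3)%N.
have nE : n = (n3 * k)%N by rewrite mulnC divnK // dvdn_part.
have n3_nat : 3%N.-nat n3 := part_pnat 3%N n.
have n30 : (0 < n3)%N := part_gt0 3%N n.
have k0 : (0 < k)%N by move: n0; rewrite nE muln_gt0 => /andP [].
have nk3 : ~~ (3 %| k)%N.
  have kE : k = (n`_(3%N^'))%N.
    by apply/eqP; rewrite -(eqn_pmul2l n30) -nE partnC.
  by rewrite kE -p'natE // part_pnat.
have eps_n3 : eps ^+ n3 = eps.
  have odd_n3 : odd n3 by rewrite /n3 p_part oddX orbT.
  case: (legendre3_cases 1 nq3) => -[_]; rewrite expr1 -/eps => ->.
    by rewrite expr1n.
  by rewrite -signr_odd odd_n3.
set I := #|_|.
have E : (3 * n * I)%:Z = \sum_(d <- divisors k)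
    moebius d * ((q%:Z ^+ n3) ^+ (k %/ d) - eps ^+ (k %/ d)).
  rewrite -(card_tripling (iota := iota) phiE tau n0); last first.
    move=> f f0 szf; apply: splitF => //; apply: leq_trans szf _; rewrite ltnS.
    by apply: leq_trans (ltnW (ltn_expl _ q1)); rewrite leq_mul2r orbT.
  rewrite {1}nE.
  apply: (moebius_inversion (b := fun j => #|tripling iota phi tau (n3 * j)|%:Z)
    (e := fun j => (q%:Z ^+ n3) ^+ j - eps ^+ j) k0) => j jk.
  have j0 : (0 < j)%N := dvdn_gt0 k0 jk.
  have jn : (n3 * j <= n)%N by rewrite nE leq_mul2l dvdn_leq ?orbT.
  rewrite -{1}eps_n3 -!exprM.
  rewrite -(card_weak_tripling_legendre phiE tau_neq0 three0 n0 splitF) //;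
    last first.
    by rewrite muln_gt0 n30.
  rewrite (card_weak_tripling_divisors iota phiE tau n3_nat) //.
    by rewrite -natz natr_sum; apply: eq_bigr => i _; rewrite natz.
  by apply: contra nk3 => /dvdn_trans; apply.
rewrite /necklace -mulrBr -sumrB.
under eq_bigr do rewrite -intrB -mulrBr.
rewrite -rmorph_sum -E /= -pmulrn {1}nE !natrM.
have n3Q : n3%:R != 0 :> rat by rewrite pnatr_eq0 -lt0n.
have kQ : k%:R != 0 :> rat by rewrite pnatr_eq0 -lt0n.
by field; rewrite n3Q kQ.
Qed.
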